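(* Let $X$ be a topological space with topology $\tau$, let $Y\subset X$, let $f:Y\to\tau$ be a neighbourhood assignment on $Y$, and let $\lambda\le|Y|$ be a regular cardinal. If $D_G^f$ is the union of fewer than $\lambda$ many pseudo weakly separated subspaces for each open $G\subset X$, then $w(X)\ge|Y|$.
   Context: $w$ denotes weight; regular cardinals are infinite. A neighbourhood assignment on $Y\subset X$ is a function $f:Y\to\tau$ with $y\in f(y)$ for each $y\in Y$. For $N\subset X$ put $D_N^f=\{y\in Y: y\in N\subset f(y)\}$. A space $Z$ is weakly separated if there is a neighbourhood assignment $g$ on $Z$ such that for all $y\ne z$ in $Z$, $y\notin g(z)$ or $z\notin g(y)$. A space $Z$ is pseudo weakly separated if it contains a weakly separated subspace $Z'$ with $|Z'|=|Z|$. *)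

(* Defs.v *)
From mathcomp Require Import all_boot all_order.
From mathcomp Require Import all_classical all_reals topology.
From mathcomp Require wochoice.

Set Implicit Arguments.
Unset Strict Implicit.
Unset Printing Implicit Defensive.

Local Open Scope classical_set_scope.
Local Open Scope card_scope.

(* Cardinals are represented by sets (or types) of that cardinality and are
   compared with #<= and #= . *)

Definition card_lt (T U : Type) (A : set T) (B : set U) : Prop :=
  A #<= B /\ ~ (B #<= A).

(* R is the (reflexive) order of an initial ordinal on L. *)
Definition initial_ordinal (L : Type) (R : rel L) : Prop :=
  wochoice.well_order R /\
  forall x : L, card_lt [set y | R y x /\ y <> x] [set: L].

Definition cofinal (L : Type) (R : rel L) (C : set L) : Prop :=
  forall x : L, exists2 c, C c & R x c.

(* The last condition says that the cofinality of |L|, i.e. the least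
   cardinality of a cofinal subset of the initial ordinal |L|, is |L|. *)
Definition regular_cardinal (L : Type) : Prop :=
  infinite_set [set: L] /\
  exists R : rel L,
    initial_ordinal R /\ forall C : set L, cofinal R C -> C #= [set: L].

Definition minimum_basis (X : topologicalType) (B : set (set X)) : Prop :=
  basis B /\ forall B' : set (set X), basis B' -> B #<= B'.

Lemma card_minimum (I T : Type) (A : I -> set T) (i0 : I) :
  exists i, forall j, A i #<= A j.
Proof.
pose good (P : set (I -> T)) :=
  (forall f, P f -> forall i, A i (f i)) /\
  (forall f g, P f -> P g -> forall i, f i = g i -> f = g).
have [P [[PA Pinj] Pmax]] : exists P, good P /\
    forall Q, P `<` Q -> ~ good Q.
  apply: Zorn_bigcup => F Fgood Ftot; split.
    by move=> f [Q FQ Qf]; exact: (Fgood _ FQ).1.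
  move=> f g [Q FQ Qf] [Q' FQ' Qg] i.
  have [QQ'|Q'Q] := Ftot _ _ FQ FQ'.
    by apply: (Fgood _ FQ').2 => //; exact: QQ'.
  by apply: (Fgood _ FQ).2 => //; exact: Q'Q.
have [i Ai] : exists i, forall a, A i a -> exists2 f, P f & f i = a.
  apply: contrapT => /forallNP nsurj.
  have /choice[a aP] : forall i, exists a, A i a /\ forall f, P f -> f i <> a.
    move=> i; have /existsNP[a /not_implyP[Aa naP]] := nsurj i.
    by exists a; split=> // f Pf fa; apply: naP; exists f.
  apply: (Pmax (a |` P)).
    split; first by move=> g Pg; right.
    by move=> /(_ a (or_introl erefl)) Pa; exact: ((aP i0).2 a).
  split=> [f [->|Pf] i|f g].
  - exact: (aP i).1.
  - exact: PA.
  - move=> [->|Pf] [->|Pg] i //.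
    + by move=> e; case: ((aP i).2 g).
    + by move=> e; case: ((aP i).2 f).
    + exact: Pinj.
exists i => j; apply: (@card_le_trans _ _ _ P).
  have PAi : A i `<=` (fun f => f i) @` P.
    by move=> a /Ai[f Pf <-]; exists f.
  exact: card_le_trans (subset_card_le PAi) (card_image_le _ _).
have Pj : (fun f => f j) @` P `<=` A j by move=> _ [f Pf <-]; exact: PA.
apply: card_le_trans (subset_card_le Pj).
have : (fun f => f j) @` P #= P.
  by apply: inj_card_eq => f g /set_mem Pf /set_mem Pg; exact: Pinj.
by rewrite card_eq_le => /andP[].
Qed.

Lemma minimum_basis_exists (X : topologicalType) :
  exists B : set (set X), minimum_basis B.
Proof.
have basis_open : basis (@open X).
  split=> // x U; rewrite nbhsE => -[V [oV Vx] VU].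
  by exists V.
have [[B bB] Bmin] := @card_minimum {B : set (set X) | basis B} _
  sval (exist _ _ basis_open).
by exists B; split=> // B' bB'; exact: (Bmin (exist _ B' bB')).
Qed.

(* A base of X of least cardinality, representing the cardinal w(X). *)
Definition weight (X : topologicalType) : set (set X) :=
  sval (cid (minimum_basis_exists X)).
Arguments weight : clear implicits.

(* The values of f outside Y are irrelevant. *)
Definition nbhd_assignment (X : topologicalType) (Y : set X) (f : X -> set X)
    : Prop :=
  forall y, Y y -> open (f y) /\ f y y.

Definition D_ (X : Type) (Y : set X) (f : X -> set X) (N : set X)
    : set X :=
  [set y | [/\ Y y, N y & N `<=` f y]].

Definition weakly_separated (Z : topologicalType) : Prop :=
  exists2 g : Z -> set Z, nbhd_assignment setT g &
    forall y z : Z, y <> z -> ~ g z y \/ ~ g y z.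

Definition pseudo_weakly_separated (Z : topologicalType) : Prop :=
  exists2 Z' : set Z, weakly_separated (set_type Z') & Z' #= [set: Z].

(* Main.v *)
(* Mapping each point z of a weakly separated space to a basic open set
   between z and g z is injective, so every pseudo weakly separated subspace Z
   of X satisfies |Z| <= w(X).  If B is a base with |B| = w(X), then Y is the
   union of the sets D_G for G in B.  If w(X) < lambda, regularity of lambda,
   used for this union and then for the covering of one D_G by fewer than
   lambda pieces, yields a piece of size at least lambda > w(X), which is
   absurd.  Hence lambda <= w(X), w(X) is infinite, and Hessenberg's theorem
   k * k = k bounds |Y| by w(X). *)

Require Import Defs.
From mathcomp Require Import all_boot all_order.
From mathcomp Require Import all_classical all_reals topology.

Local Open Scope classical_set_scope.
Local Open Scope card_scope.

(** * Comparing cardinals through relations *)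

(** Inverting such an [r] gives a partial map from [B] to [A], well defined by injectivity and onto
    by totality; [option] encodes the partiality. *)
Lemma card_le_rel {T U : Type} {A : set T} {B : set U} :
  A #<= B <-> exists2 r : T -> U -> Prop,
    (forall a, A a -> exists2 b, B b & r a b) &
    (forall a a' b, A a -> A a' -> r a b -> r a' b -> a = a').
Proof.
split=> [/ocard_geP/surjPex[h hB]|[r rAB rinj]].
  exists (fun a b => h b = Some a) => [a Aa|a a' b _ _ -> [->] //].
  by have [b Bb hb] := hB (Some a) (ex_intro2 _ _ a Aa erefl); exists b.
have /choice[h hP] : forall b, exists o : option T,
    forall a, A a -> r a b -> o = Some a.
  move=> b; have [[a [Aa rab]]|nr] := pselect (exists a, A a /\ r a b).
    by exists (Some a) => a' Aa' ra'b; congr Some; exact: rinj rab ra'b.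
  by exists None => a Aa rab; case: nr; exists a.
apply/ocard_geP/surjPex; exists h => _ [a Aa <-].
by have [b Bb rab] := rAB a Aa; exists b => //; exact: hP.
Qed.

Lemma card_le_total (T U : Type) (A : set T) (B : set U) :
  A #<= B \/ B #<= A.
Proof.
(* The sum type places both sets in one type, where [card_minimum] picks the smaller. *)
pose F (b : bool) : set (T + U) := if b then inl @` A else inr @` B.
have FA : F true #= A by apply: inj_card_eq => x y _ _ [].
have FB : F false #= B by apply: inj_card_eq => x y _ _ [].
have [[] Fmin] := card_minimum F true.
  by left; have := Fmin false; rewrite (card_le_eql FA) (card_le_eqr FB).
by right; have := Fmin true; rewrite (card_le_eql FB) (card_le_eqr FA).
Qed.

(** A point is coded by two elements of [K]: a code of an index [i], and a code of the point inside
    [F i]. The first determines [i], after which the second determines the point. *)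
Lemma bigcup_card_le (I T V : Type) (D : set I) (F : I -> set T) (K : set V) :
  K `*` K #<= K -> D #<= K -> (forall i, D i -> F i #<= K) ->
  \bigcup_(i in D) F i #<= K.
Proof.
move=> KK /card_le_rel[s sDK sinj] FK; apply: card_le_trans KK.
have /choice[r rP] : forall i, exists r : T -> V -> Prop, D i ->
    (forall a, F i a -> exists2 b, K b & r a b) /\
    (forall a a' b, F i a -> F i a' -> r a b -> r a' b -> a = a').
  move=> i; have [Di|nDi] := pselect (D i); last by exists (fun _ _ => True).
  by have /card_le_rel[r rt ri] := FK i Di; exists r.
apply/card_le_rel.
exists (fun a b => exists i, [/\ D i, F i a, s i b.1 & r i a b.2]).
  move=> a [i Di Fia]; have [k Kk sik] := sDK i Di.
  have [k' Kk' rak'] := (rP i Di).1 a Fia.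
  by exists (k, k') => //; exists i.
move=> a a' b _ _ [i [Di Fia si ri]] [j [Dj Fja sj rj]].
have ij := sinj i j _ Di Dj si sj; rewrite -ij in Fja rj.
exact: (rP i Di).2 ri rj.
Qed.

Lemma setX_card_le (T U V : Type) (A : set T) (B : set U) (K : set V) :
  K `*` K #<= K -> A #<= K -> B #<= K -> A `*` B #<= K.
Proof.
move=> KK AK BK.
have -> : A `*` B = \bigcup_(a in A) (pair a @` B).
  apply/seteqP; split=> [[a b] [/= Aa Bb]|_ [a Aa [b Bb <-]]] //.
  by exists a => //; exists b.
apply: bigcup_card_le => // a _; exact: card_le_trans (card_image_le _ _) BK.
Qed.

Lemma setU_card_le (T V : Type) (A B : set T) (K : set V) :
  infinite_set K -> K `*` K #<= K -> A #<= K -> B #<= K -> A `|` B #<= K.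
Proof.
move=> Kinf KK AK BK.
have -> : A `|` B = \bigcup_(b in [set: bool]) (if b then A else B).
  apply/seteqP; split=> [x [Ax|Bx]|x [[] _ ?]]; [by exists true|by exists false|..].
    by left.
  by right.
apply: bigcup_card_le => // [|[] _] //.
by apply: card_le_trans ((infiniteP K).1 Kinf); exact: countableP.
Qed.

(** * Hessenberg's theorem *)

Section Hessenberg.
Context {T : Type} (K : set T).

(** The domain of [P] is meant to be a full square, so its side can be read off the diagonal. *)
Let fld (P : set (T * T * T)) : set T := [set x | exists c, P (x, x, c)].

(* P is the graph of a relation from (fld P)^2 to fld P that is total and
   injective; it need not be functional, since totality and injectivity already
   give (fld P)^2 #<= fld P. *)
Let square_inj (P : set (T * T * T)) := [/\ fld P `<=` K,
  forall x y c, P (x, y, c) -> [/\ fld P x, fld P y & fld P c],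
  forall x y, fld P x -> fld P y -> exists c, P (x, y, c) &
  forall x y x' y' c, P (x, y, c) -> P (x', y', c) -> x = x' /\ y = y'].

Let fld_setX (P : set (T * T * T)) :
  square_inj P -> fld P `*` fld P #<= fld P.
Proof.
case=> _ Pfld Ptot Pinj; apply/card_le_rel.
exists (fun p c => P (p.1, p.2, c)) => [[x y] [/= Px Py]|].
  by have [c Pc] := Ptot x y Px Py; exists c => //; have [] := Pfld _ _ _ Pc.
by move=> [x y] [x' y'] c _ _ /= /Pinj/[apply] -[-> ->].
Qed.

Let fldS (P Q : set (T * T * T)) : P `<=` Q -> fld P `<=` fld Q.
Proof. by move=> PQ x [c /PQ]; exists c. Qed.

(** Each clause of [square_inj] starts from at most two triples of [P], so it is inherited from a
    good subset containing them. This serves for unions of chains. *)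
Let square_inj_directed (P : set (T * T * T)) :
  (forall p q, P p -> P q ->
     exists Q, [/\ square_inj Q, Q `<=` P, Q p & Q q]) ->
  square_inj P.
Proof.
move=> dirP; split=> [x [c Pc]|x y c Pc|x y [c Px] [d Py]|x y x' y' c Pc Pc'].
- have [Q [[QK _ _ _] _ Qc _]] := dirP _ _ Pc Pc.
  by apply: QK; exists c.
- have [Q [[_ Qf _ _] QP Qc _]] := dirP _ _ Pc Pc.
  by have [Qx Qy Qc'] := Qf _ _ _ Qc; split; exact: (fldS _ _ QP).
- have [Q [[_ _ Qt _] QP Qx Qy]] := dirP _ _ Px Py.
  have [||e Qe] := Qt x y; [by exists c|by exists d|].
  by exists e; exact: QP.
- have [Q [[_ _ _ Qi] QP Qc Qc']] := dirP _ _ Pc Pc'.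
  exact: Qi Qc Qc'.
Qed.

(** A disjoint copy of the field inside the rest of [K] leaves room to code the additional pairs of
    a larger square while old pairs keep their codes. *)
Let square_inj_extend (P : set (T * T * T)) :
  square_inj P -> infinite_set (fld P) -> fld P #<= K `\` fld P ->
  exists2 Q, square_inj Q & P `<` Q.
Proof.
move=> Psq Dinf; have DD := fld_setX P Psq.
set D := fld P in Dinf DD *; case: (Psq) => DK Pfld Ptot Pinj.
have [d0 Dd0] := infinite_setN0 Dinf.
move=> /card_le_rel[r rP rinj].
have /choice[g gP] : forall d, exists t, D d -> (K `\` D) t /\ r d t.
  move=> d; have [/rP[t Kt rdt]|nDd] := pselect (D d); first by exists t.
  by exists d0.
have DgD : D #<= g @` D.
  have : g @` D #= D.
    apply: inj_card_eq => x y /set_mem Dx /set_mem Dy gxy.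
    apply: (rinj x y (g x)) => //; first exact: (gP x Dx).2.
    by rewrite gxy; exact: (gP y Dy).2.
  by rewrite card_eq_le => /andP[].
have gDK : g @` D `<=` K `\` D by move=> _ [d /gP[? _] <-].
(* E^2 injects into g @` D, so the new pairs get values outside D. *)
pose E := D `|` g @` D.
have ED : E #<= D by apply: setU_card_le => //; exact: card_image_le.
have /card_le_rel[k kE kinj] : E `*` E #<= g @` D.
  by apply: card_le_trans DgD; exact: setX_card_le.
pose N : set (T * T * T) := [set p | [/\ E p.1.1, E p.1.2,
  ~ (D p.1.1 /\ D p.1.2), (g @` D) p.2 & k p.1 p.2]].
have fldQ : fld (P `|` N) = E.
  apply/seteqP; split=> [x [c [Pc|[]]]|x Ex] //; first by left; exists c.
  have [[c Pc]|nDx] := pselect (D x); first by exists c; left.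
  by have [c gDc kc] := kE (x, x) (conj Ex Ex); exists c; right; split=> // -[].
exists (P `|` N); last first.
  split; first exact: subsetUl.
  (* Strictness: the new point [g d0] has a diagonal triple in [N] but lies outside the field of
     [P]. *)
  have gd0 : (g @` D) (g d0) by exists d0.
  have [_ nDg] := gDK _ gd0.
  have [|c gDc kc] := kE (g d0, g d0); first by split; right.
  move=> /(_ (g d0, g d0, c)) QP; apply: (nDg); exists c; apply: QP.
  by right; split=> [||[]||] //; right.
split; rewrite ?fldQ.
- by move=> x [/DK|/gDK[]].
- move=> x y c [/Pfld[Dx Dy Dc]|[/= Ex Ey _ gc _]]; first by split; left.
  by split=> //; right.
- move=> x y Ex Ey; have [[Dx Dy]|nD] := pselect (D x /\ D y).
    by have [c Pc] := Ptot x y Dx Dy; exists c; left.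
  by have [c gc kc] := kE (x, y) (conj Ex Ey); exists c; right.
- move=> x y x' y' c [Pc|[/= Ex Ey _ gc kc]] [Pc'|[/= Ex' Ey' _ gc' kc']].
  + exact: Pinj Pc Pc'.
  + by have [_ []] := gDK c gc'; have [] := Pfld _ _ _ Pc.
  + by have [_ []] := gDK c gc; have [] := Pfld _ _ _ Pc'.
  + by have [] := kinj (x, y) (x', y') c (conj Ex Ey) (conj Ex' Ey') kc kc'.
Qed.

(** For a maximal [P] with field [D], the rest of [K] embeds in [D], since otherwise [P] could be
    extended. Hence [K] has the size of [D] and inherits its square bound. *)
Lemma card_le_setX_infinite : infinite_set K -> K `*` K #<= K.
Proof.
move=> Kinf.
have [h hK hinj] : exists2 h : nat -> T, forall n, K (h n) & injective h.
  have /card_le_rel[r rP rinj] := (infiniteP K).1 Kinf.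
  have /choice[h hP] : forall n, exists t, K t /\ r n t.
    by move=> n; have [t] := rP n I; exists t.
  exists h => [n|m n hmn]; first exact: (hP n).1.
  apply: (rinj m n (h m)) => //; first exact: (hP m).2.
  by rewrite hmn; exact: (hP n).2.
(* The seed is a countable square, coded by the pairing [choice.pickle] of natural numbers. *)
pose P0 : set (T * T * T) :=
  [set (h p.1, h p.2, h (choice.pickle p)) | p in [set: nat * nat]].
have fld0 n : fld P0 (h n) by exists (h (choice.pickle (n, n))); exists (n, n).
have P0sq : square_inj P0.
  split=> [_ [c [p _ [<- _ _]]]|x y c [p _ [<- <- <-]]|x y|] //.
  - by move=> [c [p _ [<- _ _]]] [d [q _ [<- _ _]]];
      exists (h (choice.pickle (p.1, q.1))); exists (p.1, q.1).
  - move=> x y x' y' c [[m n] _ [<- <- <-]] [[m' n'] _ [<- <- /hinj]].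
    by move/(pcan_inj choice.pickleK) => [-> ->].
(* P0 keeps the fields infinite along the Zorn argument. *)
have [P [Psq Pmax]] : exists P, square_inj (P0 `|` P) /\
    forall Q, P `<` Q -> ~ square_inj (P0 `|` Q).
  apply: Zorn_bigcup => F Fsq Ftot; apply: square_inj_directed => p q.
  move=> [P0p|[P FP Pp]] [P0q|[Q FQ Qq]].
  - by exists P0; split.
  - exists (P0 `|` Q); split=> //; [exact: Fsq|apply: setUS|left|right] => //.
    exact: bigcup_sup.
  - exists (P0 `|` P); split=> //; [exact: Fsq|apply: setUS|right|left] => //.
    exact: bigcup_sup.
  - have [PQ|QP] := Ftot _ _ FP FQ.
      exists (P0 `|` Q); split=> //; [exact: Fsq|apply: setUS|right|right] => //.
        exact: bigcup_sup.
      exact: PQ.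
    exists (P0 `|` P); split=> //; [exact: Fsq|apply: setUS|right|right] => //.
      exact: bigcup_sup.
    exact: QP.
set D := fld (P0 `|` P).
have DK : D `<=` K by case: Psq.
have DD : D `*` D #<= D := fld_setX _ Psq.
have Dinf : infinite_set D.
  apply/infiniteP/card_le_rel; exists (fun n t => h n = t) => [n _|m n t _ _ <-].
    by exists (h n) => //; apply: fldS _ _ _ (fld0 n); exact: subsetUl.
  by move/hinj.
have KD : K #<= D.
  rewrite -(setDUK DK); apply: setU_card_le => //.
  have [/(square_inj_extend _ Psq Dinf)[Q Qsq]|//] := card_le_total _ _ D (K `\` D).
  move=> [PQ nQP]; case: (Pmax Q).
    split=> [p Pp|QP]; first by apply: PQ; right.
    by apply: nQP => q /QP; right.
  suff -> : P0 `|` Q = Q by [].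
  by apply/setUidPr => p P0p; apply: PQ; left.
apply: card_le_trans (subset_card_le DK); exact: setX_card_le.
Qed.

End Hessenberg.

(** * Regular cardinals and unions *)

(** If no piece were as large as [L], the points of [L] coded into [A i] would have an upper bound
    [x i]. These bounds would form a cofinal set no larger than [I], against regularity. *)
Lemma regular_bigcup (L U T : Type) (I : set U) (A : U -> set T) :
  regular_cardinal L -> card_lt I [set: L] ->
  [set: L] #<= \bigcup_(i in I) A i -> exists2 i, I i & [set: L] #<= A i.
Proof.
move=> [Linf [R [[Rwo _] Rcof]]] [_ nLI] /card_le_rel[r rP rinj].
apply: contrapT => nA.
have Rtot x y : ~ R x y -> R y x.
  (* Totality comes from the least element of the pair [x], [y]. *)
  have [|z [[zxy zmin] _]] := Rwo [pred z | `[< z = x \/ z = y >]].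
    by exists x; apply/asboolP; left.
  have [Rzx Rzy] : R z x /\ R z y.
    by split; apply: zmin; apply/asboolP; [left|right].
  by move: zxy => /asboolP[<-|<-].
have /choice[x xP] : forall i, exists x, I i -> forall l t, A i t -> r l t -> R l x.
  move=> i; apply: contrapT => /forallNP nx; apply: nA; exists i.
    (* Outside [I] the bound is vacuous, so any element of [L] would serve. *)
    by have [l _] := infinite_setN0 Linf; apply: contrapT => nIi; apply: (nx l).
  pose C := [set l | exists2 t, A i t & r l t].
  have CA : C #<= A i.
    apply/card_le_rel; exists r => [l [t]|l l' t _ _]; first by exists t.
    exact: rinj.
  apply: card_le_trans CA; have : cofinal R C.
    (* By totality, an [l] below no element of [C] would be an upper bound of [C]. *)
    move=> l; apply: contrapT => nl; apply: (nx l) => Ii l' t At rl't.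
    by apply: Rtot => Rll'; apply: nl; exists l' => //; exists t.
  by move=> /Rcof; rewrite card_eq_le => /andP[].
apply: nLI; apply: card_le_trans (card_image_le x I).
have : cofinal R (x @` I).
  move=> l; have [t [i Ii At] rlt] := rP l Logic.I.
  by exists (x i); [exists i|exact: xP At rlt].
by move=> /Rcof; rewrite card_eq_le => /andP[].
Qed.

(** * Bases and weakly separated subspaces *)

Lemma basis_set_type (X : topologicalType) (A : set X) (B : set (set X)) :
  basis B -> basis [set (set_val @^-1` U : set (set_type A)) | U in B].
Proof.
move=> [Bopen Bnbhs]; split=> [_ [U BU <-]|x V].
  by exists U => //; exact: Bopen.
move=> [_ [[W oW <-] Wx] WV].
have [U [BU Ux] UW] := Bnbhs (set_val x) W (open_nbhs_nbhs (conj oW Wx)).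
by exists (set_val @^-1` U) => [|y /UW/WV //]; split=> //; exists U.
Qed.

(** A basic set [U] serving two points [y] and [z] would put [y] in [g z] and [z] in [g y]. *)
Lemma weakly_separated_card_le (Z : topologicalType) (B : set (set Z)) :
  basis B -> weakly_separated Z -> [set: Z] #<= B.
Proof.
move=> [_ Bnbhs] [g gnbhs gsep]; apply/card_le_rel.
exists (fun z U => U z /\ U `<=` g z) => [z _|y z U _ _ [Uy Ug] [Uz Ug']].
  by have [U [BU Uz] Ug] := Bnbhs z _ (open_nbhs_nbhs (gnbhs z I)); exists U.
by apply: contrapT => /gsep[]; apply; [exact: Ug'|exact: Ug].
Qed.

Lemma pseudo_weakly_separated_card_le (X : topologicalType) (Z : set X)
    (B : set (set X)) :
  basis B -> pseudo_weakly_separated (set_type Z) -> Z #<= B.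
Proof.
move=> Bbasis [Z' Z'sep Z'Z].
rewrite -(card_le_eql (card_setT Z)) -(card_le_eql Z'Z).
rewrite -(card_le_eql (card_setT Z')).
pose B1 := [set (set_val @^-1` U : set (set_type Z)) | U in B].
(* The base is restricted twice, from [X] to [Z] and from [Z] to [Z']; neither restriction enlarges
   it. *)
apply: card_le_trans (card_image_le (fun U => set_val @^-1` U : set Z) B).
apply: card_le_trans (card_image_le (fun U => set_val @^-1` U : set Z') _).
by apply: weakly_separated_card_le => //; do 2!apply: basis_set_type.
Qed.

Lemma weight_basis (X : topologicalType) : basis (weight X).
Proof. by rewrite /weight; case: cid => B []. Qed.

Theorem theorem2p12 (X : topologicalType) (Y : set X) (f : X -> set X)
    (L : Type)
    (hf : nbhd_assignment Y f)
    (hL : regular_cardinal L)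
    (hLY : [set: L] #<= Y)
    (hD : forall G : set X, open G ->
       exists F : set (set X),
         [/\ card_lt F [set: L],
             forall Z : set X, F Z -> pseudo_weakly_separated (set_type Z)
           & D_ Y f G = \bigcup_(Z in F) Z]) :
  Y #<= weight X.
Proof.
have [Bopen Bnbhs] := weight_basis X.
have Yle : Y `<=` \bigcup_(G in weight X) D_ Y f G.
  move=> y Yy; have [G [BG Gy] Gf] := Bnbhs y _ (open_nbhs_nbhs (hf y Yy)).
  by exists G.
have small G : weight X G -> exists F : set (set X), [/\ card_lt F [set: L],
    forall Z, F Z -> Z #<= weight X & D_ Y f G = \bigcup_(Z in F) Z].
  move=> /Bopen/hD[F [FL Fsep ->]]; exists F; split=> // Z /Fsep.
  exact/pseudo_weakly_separated_card_le/weight_basis.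
have LB : [set: L] #<= weight X.
  apply: contrapT => nLB.
  have BL : card_lt (weight X) [set: L].
    by split=> //; have [] := card_le_total _ _ [set: L] (weight X).
  (* Regularity first yields a basic [G] with [D_ Y f G] of size at least [L], then a piece [Z] of
     it that large. *)
  have [G BG] := regular_bigcup _ _ _ _ _ hL BL
    (card_le_trans hLY (subset_card_le Yle)).
  have [F [FL FB ->]] := small G BG.
  case/(regular_bigcup _ _ _ _ _ hL FL) => Z FZ LZ.
  exact: nLB (card_le_trans LZ (FB Z FZ)).
have Binf : infinite_set (weight X).
  by apply/infiniteP; apply: card_le_trans LB; apply/infiniteP; case: hL.
have BB := card_le_setX_infinite _ Binf.
apply: card_le_trans (subset_card_le Yle) _.
apply: bigcup_card_le => // G /small[F [[FL _] FB ->]].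
by apply: bigcup_card_le => //; exact: card_le_trans LB.
Qed.
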